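(* Let $\omega=\{\omega_n\}_{n\ge 0}$ be a sequence of positive real numbers with $\omega_0=1$ and $\lim_{n\to\infty}\omega_n/\omega_{n+1}=1$. Let $\mathcal{J}_\omega$ be the infinite Jacobi matrix with entries $(\mathcal{J}_\omega)_{j,j+1}=(\mathcal{J}_\omega)_{j+1,j}=\sqrt{\omega_j/\omega_{j+1}}$ for $j\ge1$ and all other entries zero, and let $$\mathcal{U}_\omega:=\sup_{f\in H^2_\omega,\ f\neq 0}\frac{|\langle f,zf\rangle_\omega|}{\|zf\|_\omega^2}.$$ Then $$\mathcal{U}_\omega=\frac{\|\mathcal{J}_\omega\|}{2},$$ where $\|\mathcal{J}_\omega\|$ denotes the operator norm of $\mathcal{J}_\omega$.
   Context: $H^2_\omega$ is the Hilbert space of functions $f(z)=\sum_{n\ge0}a_nz^n$ analytic in the open unit disk $\mathbb{D}$ with $\|f\|_\omega^2=\sum_{n\ge0}|a_n|^2\omega_n<\infty$ and inner product $\langle \sum a_nz^n,\sum b_nz^n\rangle_\omega=\sum_{n\ge0}a_n\overline{b_n}\,\omega_n$. Rows and columns of $\mathcal{J}_\omega$ are indexed by $1,2,3,\dots$, and $\mathcal{J}_\omega$ is regarded as a bounded self-adjoint operator on $\ell^2$. *)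

(* Defs.v *)
From Stdlib Require Import Reals ClassicalEpsilon.
From Coquelicot Require Export Coquelicot.
Open Scope R_scope.

Definition disk : Set := {z : C | Cmod z < 1}.

Definition power_expansion (f : disk -> C) (a : nat -> C) : Prop :=
  forall z : disk,
    is_pseries (K := C_AbsRing) (V := C_NormedModule) a (proj1_sig z) (f z).

(* The coefficients of the expansion of [f] about 0: unique when an expansion
   converging on the whole disk exists, unspecified otherwise. *)
Definition coef (f : disk -> C) : nat -> C :=
  epsilon (inhabits (fun _ : nat => RtoC 0)) (power_expansion f).

Definition H2 (omega : nat -> R) (f : disk -> C) : Prop :=
  exists a : nat -> C,
    power_expansion f a /\ ex_series (fun n => Cmod (a n) ^ 2 * omega n).

(* [Series] is only available for real terms. *)
Definition CSeries (u : nat -> C) : C :=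
  (Series (fun n => Re (u n)), Series (fun n => Im (u n))).

Definition inner_H2 (omega : nat -> R) (f g : disk -> C) : C :=
  CSeries (fun n => (coef f n * Cconj (coef g n) * RtoC (omega n))%C).

Definition norm_H2 (omega : nat -> R) (f : disk -> C) : R :=
  sqrt (Series (fun n => Cmod (coef f n) ^ 2 * omega n)).

Definition shift (f : disk -> C) : disk -> C :=
  fun z => (proj1_sig z * f z)%C.

Definition U_const (omega : nat -> R) : Rbar :=
  Lub_Rbar (fun r : R => exists f : disk -> C,
    H2 omega f /\ f <> (fun _ => RtoC 0) /\
    r = Cmod (inner_H2 omega f (shift f)) / norm_H2 omega (shift f) ^ 2).

Definition l2 (x : nat -> C) : Prop := ex_series (fun n => Cmod (x n) ^ 2).

Definition norm_l2 (x : nat -> C) : R := sqrt (Series (fun n => Cmod (x n) ^ 2)).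

(* Rows and columns of an infinite matrix are numbered from 1, while the
   coordinates of a sequence are numbered from 0: entry [n] of a sequence is
   its coordinate number [S n].  Row 0 and column 0 of [A] play no role.  This is
   meant for matrices with finitely supported rows. *)
Definition mat_apply (A : nat -> nat -> R) (x : nat -> C) : nat -> C :=
  fun j => CSeries (fun k => (RtoC (A (S j) (S k)) * x k)%C).

(* Equal to [p_infty] when [A] does not act boundedly on l2. *)
Definition op_norm (A : nat -> nat -> R) : Rbar :=
  Glb_Rbar (fun M : R => 0 <= M /\
    forall x : nat -> C, l2 x ->
      l2 (mat_apply A x) /\ norm_l2 (mat_apply A x) <= M * norm_l2 x).

Definition jacobi (omega : nat -> R) (j k : nat) : R :=
  if Nat.eqb k (S j) then sqrt (omega j / omega (S j))
  else if Nat.eqb j (S k) then sqrt (omega k / omega (S k))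
  else 0.

(* Main.v *)
(** Put [x_k = a_k sqrt (omega (k+1))], where [a] is the coefficient sequence of
    [f].  Then [||zf||^2 = ||x||^2], and [<f,zf>] is the sum of
    [c_(k+1) x_(k+1) conj x_k] with [c_n = sqrt (omega_n / omega_(n+1))], i.e. half
    the quadratic form of the Jacobi matrix [J] up to conjugations.
    A bound [||J|| <= M] bounds that form at the nonnegative sequence [|x|], which
    dominates [|<f,zf>|].  Conversely a bound [r] on the quotients, tested on
    polynomials with real coefficients, polarises to
    [<Ju,v> <= r (||u||^2 + ||v||^2)]; choosing [v = t Ju] and optimising over [t]
    gives [||Ju|| <= 2 r ||u||].  Hence the [M] bounding [J] are exactly the doubles
    of the upper bounds of the quotients. *)
Require Import Defs.
From Stdlib Require Import Reals ClassicalEpsilon FunctionalExtensionality Lra Lia.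
From Coquelicot Require Import Coquelicot.
Open Scope R_scope.

(** * Real series with nonnegative terms or finite support *)

Lemma is_series_sum_f_R0 (a : nat -> R) (l : R) :
  is_series a l <-> is_lim_seq (sum_f_R0 a) l.
Proof.
  split; intros H.
  - apply is_lim_seq_ext with (sum_n a); [intro n; apply sum_n_Reals | exact H].
  - change (is_lim_seq (sum_n a) l).
    apply is_lim_seq_ext with (sum_f_R0 a); [intro n; symmetry; apply sum_n_Reals | exact H].
Qed.

Lemma sum_f_R0_le_Series (a : nat -> R) (n : nat) :
  (forall k, 0 <= a k) -> ex_series a -> sum_f_R0 a n <= Series a.
Proof.
  intros Ha Hex.
  apply sum_incr; [|exact Ha].
  apply is_lim_seq_Reals, is_series_sum_f_R0, Series_correct, Hex.
Qed.

Lemma ex_series_bounded (a : nat -> R) (B : R) :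
  (forall k, 0 <= a k) -> (forall n, sum_f_R0 a n <= B) -> ex_series a.
Proof.
  intros Ha HB.
  destruct (ex_finite_lim_seq_incr (sum_f_R0 a) B) as [l Hl].
  - intros n; simpl; specialize (Ha (S n)); lra.
  - exact HB.
  - exists l; apply is_series_sum_f_R0; exact Hl.
Qed.

Lemma Series_le_bound (a : nat -> R) (B : R) :
  ex_series a -> (forall n, sum_f_R0 a n <= B) -> Series a <= B.
Proof.
  intros Hex HB.
  assert (H := is_lim_seq_le (sum_f_R0 a) (fun _ => B) (Series a) B HB
    (proj1 (is_series_sum_f_R0 _ _) (Series_correct _ Hex)) (is_lim_seq_const B)).
  exact H.
Qed.

Lemma sum_f_R0_term_le (a : nat -> R) (k n : nat) :
  (forall i, 0 <= a i) -> (k <= n)%nat -> a k <= sum_f_R0 a n.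
Proof.
  intros Ha Hk; induction Hk as [|n Hk IH].
  - destruct k as [|k]; [simpl; lra|].
    rewrite tech5; assert (H := cond_pos_sum a k Ha); lra.
  - rewrite tech5; specialize (Ha (S n)); lra.
Qed.

Lemma sum_f_R0_finite (a : nat -> R) (N n : nat) :
  (forall k, (N < k)%nat -> a k = 0) -> (N <= n)%nat -> sum_f_R0 a n = sum_f_R0 a N.
Proof.
  intros Ha Hn; induction Hn as [|n Hn IH]; [reflexivity|].
  simpl; rewrite IH, Ha by lia; ring.
Qed.

Lemma is_series_finite {K : AbsRing} {V : NormedModule K} (a : nat -> V) (N : nat) :
  (forall k, (N < k)%nat -> a k = zero) -> is_series a (sum_n a N).
Proof.
  intros Ha.
  assert (H : forall n, (N <= n)%nat -> sum_n a n = sum_n a N).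
  { intros n Hn; induction Hn as [|n Hn IH]; [reflexivity|].
    rewrite sum_Sn, IH, Ha by lia; apply plus_zero_r. }
  apply filterlim_ext_loc with (fun _ => sum_n a N).
  - exists N; intros n Hn; symmetry; apply H, Hn.
  - apply filterlim_const.
Qed.

Lemma Series_finite (a : nat -> R) (N : nat) :
  (forall k, (N < k)%nat -> a k = 0) -> Series a = sum_f_R0 a N.
Proof.
  intros Ha; rewrite <- sum_n_Reals.
  apply is_series_unique, (is_series_finite (V := R_NormedModule)), Ha.
Qed.

(** * Complex series and their real and imaginary parts *)

Lemma fst_sum_n (u : nat -> C) (n : nat) :
  fst (sum_n (G := C_NormedModule) u n) = sum_f_R0 (fun k => fst (u k)) n.
Proof.
  induction n as [|n IH].
  - rewrite sum_O; reflexivity.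
  - rewrite sum_Sn; simpl; rewrite <- IH; reflexivity.
Qed.

Lemma snd_sum_n (u : nat -> C) (n : nat) :
  snd (sum_n (G := C_NormedModule) u n) = sum_f_R0 (fun k => snd (u k)) n.
Proof.
  induction n as [|n IH].
  - rewrite sum_O; reflexivity.
  - rewrite sum_Sn; simpl; rewrite <- IH; reflexivity.
Qed.

Lemma is_series_fst (u : nat -> C) (l : C) :
  is_series (V := C_NormedModule) u l -> is_series (fun k => fst (u k)) (fst l).
Proof.
  intros H; apply is_series_sum_f_R0.
  apply is_lim_seq_ext with (fun n => fst (sum_n (G := C_NormedModule) u n)).
  - apply fst_sum_n.
  - apply (filterlim_comp _ _ _ (sum_n (G := C_NormedModule) u) fst _ (locally l)).
    + exact H.
    + destruct l; apply continuous_fst.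
Qed.

Lemma is_series_snd (u : nat -> C) (l : C) :
  is_series (V := C_NormedModule) u l -> is_series (fun k => snd (u k)) (snd l).
Proof.
  intros H; apply is_series_sum_f_R0.
  apply is_lim_seq_ext with (fun n => snd (sum_n (G := C_NormedModule) u n)).
  - apply snd_sum_n.
  - apply (filterlim_comp _ _ _ (sum_n (G := C_NormedModule) u) snd _ (locally l)).
    + exact H.
    + destruct l; apply continuous_snd.
Qed.

Lemma Cmod_sum_n_le (u : nat -> C) (n : nat) :
  Cmod (sum_n (G := C_NormedModule) u n) <= sum_f_R0 (fun k => Cmod (u k)) n.
Proof.
  induction n as [|n IH].
  - rewrite sum_O; simpl; lra.
  - rewrite sum_Sn; simpl.
    eapply Rle_trans; [apply Cmod_triangle | apply Rplus_le_compat_r, IH].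
Qed.

Lemma Cmod_sqr (z : C) : Cmod z ^ 2 = fst z ^ 2 + snd z ^ 2.
Proof.
  unfold Cmod; rewrite pow2_sqrt; [reflexivity|].
  apply Rplus_le_le_0_compat; apply pow2_ge_0.
Qed.

Lemma im_le_Cmod (z : C) : Rabs (Im z) <= Cmod z.
Proof. eapply Rle_trans; [apply Rmax_r | apply Rmax_Cmod]. Qed.

(** [CSeries] is built componentwise, so the triangle inequality is applied to the partial sums;
    their squared modulus is a polynomial in the two real partial sums, and the bound [B ^ 2] passes
    to the limit. *)
Lemma Cmod_CSeries_le (u : nat -> C) (B : R) :
  (forall n, sum_f_R0 (fun k => Cmod (u k)) n <= B) -> Cmod (CSeries u) <= B.
Proof.
  intros HB.
  assert (Hex : ex_series (fun k => Cmod (u k)))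
    by (apply ex_series_bounded with B; [intro; apply Cmod_ge_0 | exact HB]).
  assert (HB0 : 0 <= B).
  { eapply Rle_trans; [apply (Cmod_ge_0 (u 0%nat)) | apply (HB 0%nat)]. }
  assert (Hre : is_lim_seq (sum_f_R0 (fun k => fst (u k))) (Series (fun k => Re (u k)))).
  { apply is_series_sum_f_R0.
    apply (Series_correct (fun k => Re (u k))).
    apply (ex_series_le (fun k => Re (u k)) (fun k => Cmod (u k))); [|exact Hex].
    intro; apply re_le_Cmod. }
  assert (Him : is_lim_seq (sum_f_R0 (fun k => snd (u k))) (Series (fun k => Im (u k)))).
  { apply is_series_sum_f_R0.
    apply (Series_correct (fun k => Im (u k))).
    apply (ex_series_le (fun k => Im (u k)) (fun k => Cmod (u k))); [|exact Hex].
    intro; apply im_le_Cmod. }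
  apply Rsqr_incr_0_var; [|exact HB0].
  rewrite !Rsqr_pow2.
  rewrite Cmod_sqr; simpl fst; simpl snd.
  apply (is_lim_seq_le
    (fun n => sum_f_R0 (fun k => fst (u k)) n * sum_f_R0 (fun k => fst (u k)) n
      + sum_f_R0 (fun k => snd (u k)) n * sum_f_R0 (fun k => snd (u k)) n)
    (fun _ => B ^ 2) (Finite _) (Finite (B ^ 2))).
  2: { rewrite <- 2!Rsqr_pow2; unfold Rsqr.
       apply is_lim_seq_plus'; apply is_lim_seq_mult'; assumption. }
  2: apply is_lim_seq_const.
  intros n.
  rewrite <- fst_sum_n, <- snd_sum_n.
  replace (_ + _) with (Cmod (sum_n (G := C_NormedModule) u n) ^ 2)
    by (rewrite Cmod_sqr; ring).
  apply pow_incr; split; [apply Cmod_ge_0|].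
  eapply Rle_trans; [apply Cmod_sum_n_le | apply HB].
Qed.

(** * Finite sections of a Jacobi matrix and of its quadratic form *)

(** Coordinate [j] of [J u], where [J] is the symmetric matrix with zero diagonal whose entry
    [c (S k)] couples the coordinates [k] and [S k]. *)
Definition jacobi_action (c u : nat -> R) (j : nat) : R :=
  c (S j) * u (S j) + match j with O => 0 | S i => c j * u i end.

(** Each coupling is counted once, which gives half of [<J u, u>]. The last term reaches coordinate
    [S n]. *)
Definition jacobi_form (c u : nat -> R) (n : nat) : R :=
  sum_f_R0 (fun k => c (S k) * u (S k) * u k) n.

Definition truncate (n : nat) (u : nat -> R) (k : nat) : R :=
  if Nat.leb k n then u k else 0.

Lemma truncate_le (n : nat) (u : nat -> R) (k : nat) :
  (k <= n)%nat -> truncate n u k = u k.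
Proof. intros H; unfold truncate; destruct (Nat.leb_spec k n); [reflexivity | lia]. Qed.

Lemma truncate_gt (n : nat) (u : nat -> R) (k : nat) :
  (n < k)%nat -> truncate n u k = 0.
Proof. intros H; unfold truncate; destruct (Nat.leb_spec k n); [lia | reflexivity]. Qed.

(** Summation by parts: the subdiagonal terms are reindexed by one, and [v (S n) = 0] removes the
    boundary term. *)
Lemma jacobi_action_pairing (c u v : nat -> R) (n : nat) :
  v (S n) = 0 ->
  sum_f_R0 (fun j => jacobi_action c u j * v j) n
  = sum_f_R0 (fun k => c (S k) * (u (S k) * v k + v (S k) * u k)) n.
Proof.
  intros Hv.
  (* The induction needs the identity without the hypothesis on [v], so the boundary term is kept
     explicitly. *)
  enough (H : sum_f_R0 (fun j => jacobi_action c u j * v j) n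
    = sum_f_R0 (fun k => c (S k) * (u (S k) * v k + v (S k) * u k)) n
      - c (S n) * v (S n) * u n) by (rewrite H, Hv; ring).
  clear Hv; induction n as [|n IH].
  - unfold jacobi_action; simpl; ring.
  - rewrite !tech5, IH; unfold jacobi_action; ring.
Qed.

Lemma jacobi_form_polarization (c u v : nat -> R) (n : nat) :
  2 * sum_f_R0 (fun k => c (S k) * (u (S k) * v k + v (S k) * u k)) n
  = jacobi_form c (fun k => u k + v k) n - jacobi_form c (fun k => u k - v k) n.
Proof.
  unfold jacobi_form; induction n as [|n IH].
  - simpl; ring.
  - rewrite !tech5, Rmult_plus_distr_l, IH; ring.
Qed.

Lemma parallelogram_sum (u v : nat -> R) (n : nat) :
  sum_f_R0 (fun k => (u k + v k) ^ 2) n + sum_f_R0 (fun k => (u k - v k) ^ 2) n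
  = 2 * (sum_f_R0 (fun k => u k ^ 2) n + sum_f_R0 (fun k => v k ^ 2) n).
Proof.
  induction n as [|n IH].
  - simpl; ring.
  - rewrite !tech5.
    replace (sum_f_R0 (fun k => (u k + v k) ^ 2) n)
      with (2 * (sum_f_R0 (fun k => u k ^ 2) n + sum_f_R0 (fun k => v k ^ 2) n)
            - sum_f_R0 (fun k => (u k - v k) ^ 2) n) by lra.
    ring.
Qed.

Lemma sum_sqr_nonneg (u : nat -> R) (n : nat) : 0 <= sum_f_R0 (fun k => u k ^ 2) n.
Proof. apply cond_pos_sum; intro; apply pow2_ge_0. Qed.

(** For a symmetric matrix, a bound on the quadratic form bounds the operator, by polarisation and
    the parallelogram law. Row [n] reads coordinate [S n], hence the longer sum on the right. *)
Lemma jacobi_action_le_of_form_le (c : nat -> R) (r : R) :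
  0 <= r ->
  (forall n u, (forall k, (n < k)%nat -> u k = 0) ->
    Rabs (jacobi_form c u n) <= r * sum_f_R0 (fun k => u k ^ 2) n) ->
  forall n u, sum_f_R0 (fun j => jacobi_action c u j ^ 2) n
    <= (2 * r) ^ 2 * sum_f_R0 (fun k => u k ^ 2) (S n).
Proof.
  intros Hr Hform n u.
  set (S1 := sum_f_R0 (fun j => jacobi_action c u j ^ 2) n).
  set (A := sum_f_R0 (fun k => u k ^ 2) (S n)).
  (* The form bound on [u + v] and [u - v] for [v = t J u], then optimised over [t]. *)
  assert (Ht : forall t, t * S1 <= r * (A + t ^ 2 * S1)).
  { intros t.
    set (u' := truncate (S n) u).
    set (v := truncate n (fun k => t * jacobi_action c u k)).
    (* [u'] is cut at [S n], so that rows up to [n] are unchanged; [v] is cut at [n], so that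
       pairing with it sees only those rows. *)
    assert (Hv : v (S n) = 0) by (apply truncate_gt; lia).
    assert (Hv2 : v (S (S n)) = 0) by (apply truncate_gt; lia).
    assert (Hpair : sum_f_R0 (fun j => jacobi_action c u' j * v j) (S n) = t * S1).
    { rewrite tech5, Hv, Rmult_0_r, Rplus_0_r.
      unfold S1; rewrite scal_sum; apply sum_eq; intros i Hi.
      unfold v; rewrite truncate_le by lia.
      replace (jacobi_action c u' i) with (jacobi_action c u i); [ring|].
      unfold jacobi_action, u'; rewrite truncate_le by lia.
      destruct i as [|i]; [reflexivity | rewrite truncate_le by lia; reflexivity]. }
    assert (Hu' : sum_f_R0 (fun k => u' k ^ 2) (S n) = A).
    { apply sum_eq; intros i Hi; unfold u'; rewrite truncate_le by lia; reflexivity. }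
    assert (Hv' : sum_f_R0 (fun k => v k ^ 2) (S n) = t ^ 2 * S1).
    { rewrite tech5, Hv.
      unfold S1; rewrite scal_sum.
      replace (0 ^ 2) with 0 by ring; rewrite Rplus_0_r.
      apply sum_eq; intros i Hi; unfold v; rewrite truncate_le by lia; ring. }
    assert (Hvan : forall k, (S n < k)%nat -> u' k = 0 /\ v k = 0)
      by (intros k Hk; split; apply truncate_gt; lia).
    assert (Hplus := Hform (S n) (fun k => u' k + v k)).
    assert (Hminus := Hform (S n) (fun k => u' k - v k)).
    assert (Hp := jacobi_form_polarization c u' v (S n)).
    rewrite <- jacobi_action_pairing, Hpair in Hp by exact Hv2.
    assert (Hpl := parallelogram_sum u' v (S n)).
    rewrite Hu', Hv' in Hpl.
    apply (f_equal (Rmult r)) in Hpl.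
    cut (2 * (t * S1) <= r * (2 * (A + t ^ 2 * S1))); [lra|].
    rewrite Hp, <- Hpl, Rmult_plus_distr_l.
    apply Rplus_le_compat.
    - eapply Rle_trans; [apply Rle_abs | apply Hplus].
      intros k Hk; destruct (Hvan k Hk) as [-> ->]; ring.
    - rewrite <- Rabs_Ropp in Hminus.
      eapply Rle_trans; [apply Rle_abs | apply Hminus].
      intros k Hk; destruct (Hvan k Hk) as [-> ->]; ring. }
  destruct (Rle_lt_or_eq_dec 0 r Hr) as [Hr0|<-].
  (* This value maximises [t - r * t ^ 2]; multiplying by [4 * r] then clears the denominators. *)
  - specialize (Ht (/ (2 * r))).
    apply (Rmult_le_compat_l (4 * r)) in Ht; [|lra].
    replace (4 * r * (/ (2 * r) * S1)) with (2 * S1) in Ht by (field; lra).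
    replace (4 * r * (r * (A + (/ (2 * r)) ^ 2 * S1))) with ((2 * r) ^ 2 * A + S1) in Ht
      by (field; lra).
    lra.
  (* For [r = 0] the right-hand side vanishes, and any positive [t] gives [S1 <= 0]. *)
  - specialize (Ht 1); lra.
Qed.

(** This is Cauchy-Schwarz for [<J u, u>], obtained by expanding the square of [t J u - u] and
    optimising over [t]. The form at [n] involves [u (S n)], so the section of length [S n] is
    used. *)
Lemma jacobi_form_le_of_action_le (c : nat -> R) (M : R) :
  0 <= M ->
  (forall n u, (forall k, (n < k)%nat -> u k = 0) ->
    sum_f_R0 (fun j => jacobi_action c u j ^ 2) n
    <= M ^ 2 * sum_f_R0 (fun k => u k ^ 2) n) ->
  forall n u, jacobi_form c u n <= M / 2 * sum_f_R0 (fun k => u k ^ 2) (S n).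
Proof.
  intros HM Hact n u.
  set (u' := truncate (S n) u).
  assert (Hvan : forall k, (S n < k)%nat -> u' k = 0) by (intros; apply truncate_gt; lia).
  set (X := sum_f_R0 (fun j => jacobi_action c u' j * u' j) (S n)).
  set (A := sum_f_R0 (fun k => u' k ^ 2) (S n)).
  set (T := sum_f_R0 (fun j => jacobi_action c u' j ^ 2) (S n)).
  assert (HA : sum_f_R0 (fun k => u k ^ 2) (S n) = A).
  { apply sum_eq; intros i Hi; unfold u'; rewrite truncate_le by lia; reflexivity. }
  (* Pairing [u'] with itself counts every coupling twice; the one leading out of the section
     vanishes. *)
  assert (HX : X = 2 * jacobi_form c u n).
  { unfold X; rewrite jacobi_action_pairing by (apply Hvan; lia).
    rewrite tech5, (Hvan (S (S n))) by lia.
    unfold jacobi_form; rewrite scal_sum.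
    replace (c (S (S n)) * (0 * u' (S n) + 0 * u' (S n))) with 0 by ring.
    rewrite Rplus_0_r; apply sum_eq; intros i Hi.
    unfold u'; rewrite !truncate_le by lia; ring. }
  assert (HT : T <= M ^ 2 * A) by (apply Hact, Hvan).
  assert (HA0 : 0 <= A) by apply sum_sqr_nonneg.
  assert (Ht : forall t, 2 * t * X <= (t ^ 2 * M ^ 2 + 1) * A).
  { intros t.
    apply Rle_trans with (t ^ 2 * T + A).
    - unfold X, T, A; rewrite !scal_sum, <- sum_plus.
      apply sum_Rle; intros i _.
      assert (H := pow2_ge_0 (t * jacobi_action c u' i - u' i)); simpl in *; lra.
    - assert (H := Rmult_le_compat_l (t ^ 2) _ _ (pow2_ge_0 t) HT); lra. }
  rewrite HA.
  enough (X <= M * A) by lra.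
  destruct (Rle_lt_or_eq_dec 0 M HM) as [HM0|<-].
  (* At this [t] the bound reads [2 X / M <= 2 A]. *)
  - specialize (Ht (/ M)).
    apply (Rmult_le_compat_l M) in Ht; [|lra].
    replace (M * (2 * / M * X)) with (2 * X) in Ht by (field; lra).
    replace (M * (((/ M) ^ 2 * M ^ 2 + 1) * A)) with (2 * (M * A)) in Ht by (field; lra).
    lra.
  - rewrite Rmult_0_l; apply Rnot_lt_le; intros HX0.
    (* If [X > 0] with [M = 0], then [2 t X <= A] for every [t]; this [t] makes the left side
       [2 A + 2 X], a contradiction. *)
    specialize (Ht (A / X + 1)).
    replace (2 * (A / X + 1) * X) with (2 * A + 2 * X) in Ht by (field; lra).
    simpl in Ht; lra.
Qed.

(** * The Jacobi matrix as an operator on [l2] *)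

Definition jacobi_weight (omega : nat -> R) (n : nat) : R := sqrt (omega n / omega (S n)).

Lemma sum_f_R0_single (a : nat -> R) (m n : nat) :
  (forall k, k <> m -> a k = 0) -> (m <= n)%nat -> sum_f_R0 a n = a m.
Proof.
  intros Ha Hm; rewrite (sum_f_R0_finite a m) by (try assumption; intros; apply Ha; lia).
  destruct m as [|m]; [reflexivity|].
  rewrite tech5, (sum_eq _ (fun _ => 0)), sum_cte; [ring|].
  intros; apply Ha; lia.
Qed.

Lemma jacobi_row_sum (omega u : nat -> R) (j : nat) :
  Series (fun k => jacobi omega (S j) (S k) * u k)
  = jacobi_action (jacobi_weight omega) u j.
Proof.
  rewrite (Series_finite _ (S j)).
  2: { intros k Hk; unfold jacobi.
       destruct (Nat.eqb_spec (S k) (S (S j))); [lia|].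
       destruct (Nat.eqb_spec (S j) (S (S k))); [lia | ring]. }
  (* Row [j] is split into its right and left neighbours, each a sum with at most one nonzero term;
     the left one is empty when [j = 0]. *)
  rewrite (sum_eq _ (fun k =>
    (if Nat.eqb k (S j) then jacobi_weight omega (S j) * u k else 0)
    + (if Nat.eqb j (S k) then jacobi_weight omega (S k) * u k else 0))).
  2: { intros k _; unfold jacobi, jacobi_weight.
       change (Nat.eqb (S k) (S (S j))) with (Nat.eqb k (S j)).
       change (Nat.eqb (S j) (S (S k))) with (Nat.eqb j (S k)).
       destruct (Nat.eqb_spec k (S j)), (Nat.eqb_spec j (S k)); subst; try lia; ring. }
  rewrite sum_plus; unfold jacobi_action; f_equal.
  - rewrite (sum_f_R0_single _ (S j)); [rewrite Nat.eqb_refl; reflexivity | | lia].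
    intros k Hk; rewrite (proj2 (Nat.eqb_neq _ _)) by exact Hk; reflexivity.
  - destruct j as [|j].
    + simpl; ring.
    + rewrite (sum_f_R0_single _ j); [rewrite Nat.eqb_refl; reflexivity | | lia].
      intros k Hk; rewrite (proj2 (Nat.eqb_neq _ _)) by lia; reflexivity.
Qed.

(** A real matrix acts separately on real and imaginary parts, which reduces the complex operator to
    [jacobi_action]. *)
Lemma mat_apply_jacobi (omega : nat -> R) (x : nat -> C) (j : nat) :
  mat_apply (jacobi omega) x j
  = (jacobi_action (jacobi_weight omega) (fun k => fst (x k)) j,
     jacobi_action (jacobi_weight omega) (fun k => snd (x k)) j).
Proof.
  unfold mat_apply, CSeries; f_equal; rewrite <- jacobi_row_sum;
    apply Series_ext; intros k; simpl; ring.
Qed.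

(** Worded exactly as the predicate inside [op_norm], so that the two match by conversion. *)
Definition l2_bound (A : nat -> nat -> R) (M : R) : Prop :=
  0 <= M /\ forall x : nat -> C, l2 x ->
    l2 (mat_apply A x) /\ norm_l2 (mat_apply A x) <= M * norm_l2 x.

Lemma sum_Cmod_sqr (x : nat -> C) (n : nat) :
  sum_f_R0 (fun k => Cmod (x k) ^ 2) n
  = sum_f_R0 (fun k => fst (x k) ^ 2) n + sum_f_R0 (fun k => snd (x k) ^ 2) n.
Proof. rewrite <- sum_plus; apply sum_eq; intros; apply Cmod_sqr. Qed.

Lemma Cmod_sqr_nonneg (x : nat -> C) (k : nat) : 0 <= Cmod (x k) ^ 2.
Proof. apply pow2_ge_0. Qed.

(** The section bounds for real and imaginary parts add up to one for moduli, uniform in [n]; this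
    yields both membership in [l2] and the norm estimate. *)
Lemma l2_bound_of_action_le (omega : nat -> R) (M : R) :
  0 <= M ->
  (forall n u, sum_f_R0 (fun j => jacobi_action (jacobi_weight omega) u j ^ 2) n
    <= M ^ 2 * sum_f_R0 (fun k => u k ^ 2) (S n)) ->
  l2_bound (jacobi omega) M.
Proof.
  intros HM Hact; split; [exact HM|]; intros x Hx.
  assert (HB : forall n, sum_f_R0 (fun k => Cmod (mat_apply (jacobi omega) x k) ^ 2) n
    <= M ^ 2 * Series (fun k => Cmod (x k) ^ 2)).
  { intros n.
    apply Rle_trans with (M ^ 2 * sum_f_R0 (fun k => Cmod (x k) ^ 2) (S n)).
    - rewrite !sum_Cmod_sqr, Rmult_plus_distr_l.
      apply Rplus_le_compat; (eapply Rle_trans; [|apply Hact]);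
        right; apply sum_eq; intros; rewrite mat_apply_jacobi; reflexivity.
    - apply Rmult_le_compat_l; [apply pow2_ge_0|].
      apply sum_f_R0_le_Series; [apply Cmod_sqr_nonneg | exact Hx]. }
  assert (Hex : l2 (mat_apply (jacobi omega) x))
    by (eapply ex_series_bounded; [apply Cmod_sqr_nonneg | exact HB]).
  split; [exact Hex|].
  unfold norm_l2; rewrite <- (sqrt_pow2 M HM), <- sqrt_mult_alt by apply pow2_ge_0.
  apply sqrt_le_1_alt, Series_le_bound; assumption.
Qed.

(** The operator bound is tested on a real, finitely supported vector. *)
Lemma action_le_of_l2_bound (omega : nat -> R) (M : R) :
  l2_bound (jacobi omega) M ->
  forall n u, (forall k, (n < k)%nat -> u k = 0) ->
    sum_f_R0 (fun j => jacobi_action (jacobi_weight omega) u j ^ 2) n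
    <= M ^ 2 * sum_f_R0 (fun k => u k ^ 2) n.
Proof.
  intros [HM Hbound] n u Hu.
  set (x := fun k => RtoC (u k)).
  assert (Hxu : forall k, Cmod (x k) ^ 2 = u k ^ 2).
  { intros k; rewrite Cmod_sqr; simpl; ring. }
  assert (HS : Series (fun k => Cmod (x k) ^ 2) = sum_f_R0 (fun k => u k ^ 2) n).
  { rewrite (Series_finite _ n).
    - apply sum_eq; intros; apply Hxu.
    - intros k Hk; rewrite Hxu, Hu by exact Hk; ring. }
  assert (Hx : l2 x).
  { exists (sum_n (fun k => Cmod (x k) ^ 2) n).
    apply (is_series_finite (V := R_NormedModule)).
    intros k Hk; rewrite Hxu, Hu by exact Hk; unfold zero; simpl; ring. }
  destruct (Hbound x Hx) as [Hl2 Hn].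
  apply Rle_trans with (Series (fun k => Cmod (mat_apply (jacobi omega) x k) ^ 2)).
  - eapply Rle_trans; [|apply (sum_f_R0_le_Series _ n); [apply Cmod_sqr_nonneg | exact Hl2]].
    apply sum_Rle; intros j _; rewrite mat_apply_jacobi, Cmod_sqr; simpl fst; simpl snd.
    rewrite <- (Rplus_0_r (_ ^ 2)) at 1.
    apply Rplus_le_compat; [right; reflexivity | apply pow2_ge_0].
  - unfold norm_l2 in Hn; rewrite HS in Hn.
    rewrite <- (sqrt_pow2 M HM), <- sqrt_mult_alt in Hn by apply pow2_ge_0.
    apply sqrt_le_0; [ | | exact Hn].
    + eapply Rle_trans; [|apply (sum_f_R0_le_Series _ 0%nat); [apply Cmod_sqr_nonneg | exact Hl2]].
      apply Cmod_sqr_nonneg.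
    + apply Rmult_le_pos; [apply pow2_ge_0 | apply sum_sqr_nonneg].
Qed.

(** * Uniqueness of power series coefficients *)

(** The terms of a convergent series are bounded, so the radius is at least [Rabs x]. *)
Lemma CV_radius_pos (a : nat -> R) (x : R) :
  x <> 0 -> ex_series (fun k => a k * x ^ k) -> Rbar_lt 0 (CV_radius a).
Proof.
  intros Hx Hex.
  apply Rbar_lt_le_trans with (Rabs x).
  - apply Rabs_pos_lt, Hx.
  - destruct (CV_radius_bounded a) as [Hub _]; apply Hub.
    destruct (maj_by_pos (fun k => a k * x ^ k)) as (l & _ & Hl).
    { exists 0; apply is_lim_seq_Reals; apply ex_series_lim_0, Hex. }
    exists l; intros n.
    rewrite Rabs_mult, <- RPow_abs, Rabs_Rabsolu, RPow_abs, <- Rabs_mult; apply Hl.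
Qed.

Lemma PSeries_coef_unique (a b : nat -> R) :
  (forall x, Rabs x < 1 -> exists l,
    is_series (fun k => x ^ k * a k) l /\ is_series (fun k => x ^ k * b k) l) ->
  forall n, a n = b n.
Proof.
  intros H n.
  assert (Habs : Rabs (/ 2) < 1) by (rewrite Rabs_pos_eq; lra).
  destruct (H _ Habs) as (l & Ha & Hb).
  apply PSeries_ext_recip.
  - apply CV_radius_pos with (/ 2); [lra|]; exists l.
    eapply is_series_ext; [|exact Ha]; intros; apply Rmult_comm.
  - apply CV_radius_pos with (/ 2); [lra|]; exists l.
    eapply is_series_ext; [|exact Hb]; intros; apply Rmult_comm.
  - exists (mkposreal 1 Rlt_0_1); intros x Hx.
    destruct (H x) as (l' & Ha' & Hb').
    { change (Rabs (x - 0) < 1) in Hx; rewrite Rminus_0_r in Hx; exact Hx. }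
    unfold PSeries; transitivity l'.
    + apply is_series_unique; eapply is_series_ext; [|exact Ha']; intros; apply Rmult_comm.
    + symmetry; apply is_series_unique; eapply is_series_ext; [|exact Hb']; intros; apply Rmult_comm.
Qed.

Lemma pow_n_RtoC (x : R) (k : nat) : pow_n (K := C_AbsRing) (RtoC x) k = RtoC (x ^ k).
Proof.
  induction k as [|k IH]; [reflexivity|].
  simpl; rewrite IH; symmetry; apply RtoC_mult.
Qed.

(* Restricting to the real diameter reduces this to real power series. *)
Lemma power_expansion_unique (f : disk -> C) (a b : nat -> C) :
  power_expansion f a -> power_expansion f b -> a = b.
Proof.
  intros Ha Hb; apply functional_extensionality; intros n.
  assert (Hreal : forall x, Rabs x < 1 -> exists l : C,
    (is_series (fun k => x ^ k * fst (a k)) (fst l) /\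
     is_series (fun k => x ^ k * fst (b k)) (fst l)) /\
    (is_series (fun k => x ^ k * snd (a k)) (snd l) /\
     is_series (fun k => x ^ k * snd (b k)) (snd l))).
  { intros x Hx.
    assert (Hz : Cmod (RtoC x) < 1) by (rewrite Cmod_R; exact Hx).
    exists (f (exist _ _ Hz)).
    specialize (Ha (exist _ _ Hz)); specialize (Hb (exist _ _ Hz)).
    simpl in Ha, Hb.
    split; split.
    - eapply is_series_ext; [|apply is_series_fst, Ha].
      intros k; simpl; rewrite pow_n_RtoC; simpl; ring.
    - eapply is_series_ext; [|apply is_series_fst, Hb].
      intros k; simpl; rewrite pow_n_RtoC; simpl; ring.
    - eapply is_series_ext; [|apply is_series_snd, Ha].
      intros k; simpl; rewrite pow_n_RtoC; simpl; ring.
    - eapply is_series_ext; [|apply is_series_snd, Hb].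
      intros k; simpl; rewrite pow_n_RtoC; simpl; ring. }
  rewrite (surjective_pairing (a n)), (surjective_pairing (b n)); f_equal.
  - apply (PSeries_coef_unique (fun k => fst (a k)) (fun k => fst (b k))).
    intros x Hx; destruct (Hreal x Hx) as (l & H & _); exists (fst l); exact H.
  - apply (PSeries_coef_unique (fun k => snd (a k)) (fun k => snd (b k))).
    intros x Hx; destruct (Hreal x Hx) as (l & _ & H); exists (snd l); exact H.
Qed.

(** Uniqueness of the expansion pins down the sequence picked by [epsilon]. *)
Lemma coef_power_expansion (f : disk -> C) (a : nat -> C) :
  power_expansion f a -> coef f = a.
Proof.
  intros Ha; apply power_expansion_unique with f; [|exact Ha].
  unfold coef; apply epsilon_spec; exists a; exact Ha.
Qed.

(** * Inner product and norm of [zf] in terms of coefficients *)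

Lemma coef_shift (f : disk -> C) (a : nat -> C) :
  power_expansion f a -> coef (shift f) = PS_incr_1 (V := C_NormedModule) a.
Proof.
  intros Ha; apply coef_power_expansion; intros z.
  apply (is_pseries_incr_1 (V := C_NormedModule)), Ha.
Qed.

Lemma inner_shift (omega : nat -> R) (f : disk -> C) (a : nat -> C) :
  power_expansion f a ->
  inner_H2 omega f (shift f)
  = CSeries (fun k => (a (S k) * Cconj (a k) * RtoC (omega (S k)))%C).
Proof.
  intros Ha; unfold inner_H2, CSeries.
  rewrite (coef_power_expansion _ _ Ha), (coef_shift _ _ Ha).
  (* The constant coefficient of [zf] is zero, so the term of index 0 drops out and the sum is
     reindexed. *)
  f_equal; rewrite Series_incr_1_aux; try reflexivity; simpl; ring.
Qed.

Lemma norm_shift_sqr (omega : nat -> R) (f : disk -> C) (a : nat -> C) :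
  (forall n, 0 < omega n) ->
  power_expansion f a ->
  ex_series (fun k => Cmod (a k) ^ 2 * omega (S k)) ->
  norm_H2 omega (shift f) ^ 2 = Series (fun k => Cmod (a k) ^ 2 * omega (S k)).
Proof.
  intros Hom Ha Hex; unfold norm_H2.
  rewrite (coef_shift _ _ Ha), Series_incr_1_aux.
  - apply pow2_sqrt.
    assert (Hpos : forall k, 0 <= Cmod (a k) ^ 2 * omega (S k)).
    { intros k; apply Rmult_le_pos; [apply pow2_ge_0 | apply Rlt_le, Hom]. }
    eapply Rle_trans; [apply (Hpos 0%nat) | apply (sum_f_R0_le_Series _ 0%nat Hpos Hex)].
  - simpl; unfold zero; simpl.
    change (Cmod (RtoC 0) * (Cmod (RtoC 0) * 1) * omega 0%nat = 0).
    rewrite Cmod_0; ring.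
Qed.

(* The coefficients of [zf] in the orthonormal basis [z^(k+1) / sqrt (omega (k+1))]. *)
Definition normalized (omega : nat -> R) (a : nat -> C) (k : nat) : R :=
  Cmod (a k) * sqrt (omega (S k)).

Lemma normalized_sqr (omega : nat -> R) (a : nat -> C) (k : nat) :
  0 < omega (S k) -> normalized omega a k ^ 2 = Cmod (a k) ^ 2 * omega (S k).
Proof.
  intros H; unfold normalized; rewrite Rpow_mult_distr, pow2_sqrt; [reflexivity | lra].
Qed.

(** The denominator of the weight cancels [sqrt (omega (S (S k)))], and the two remaining roots
    multiply to [omega (S k)]. *)
Lemma jacobi_weight_mult (omega : nat -> R) (k : nat) (x y : R) :
  (forall n, 0 < omega n) ->
  jacobi_weight omega (S k) * (x * sqrt (omega (S (S k)))) * (y * sqrt (omega (S k)))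
  = x * y * omega (S k).
Proof.
  intros Hom; unfold jacobi_weight.
  rewrite sqrt_div_alt by apply Hom.
  assert (H := sqrt_lt_R0 _ (Hom (S (S k)))).
  rewrite <- (sqrt_sqrt (omega (S k))) at 3 by apply Rlt_le, Hom.
  field; lra.
Qed.

(** * Quotients of the form and bounds of the matrix *)

Definition rayleigh_set (omega : nat -> R) (r : R) : Prop :=
  exists f : disk -> C, H2 omega f /\ f <> (fun _ => RtoC 0) /\
    r = Cmod (inner_H2 omega f (shift f)) / norm_H2 omega (shift f) ^ 2.

(** The inverse ratios also converge, hence are bounded. This makes multiplication by [z] bounded on
    the weighted space, so that [zf] has finite norm. *)
Lemma weight_ratio_bounded (omega : nat -> R) :
  (forall n, 0 < omega n) ->
  is_lim_seq (fun n => omega n / omega (S n)) 1 ->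
  exists K, 0 < K /\ forall n, omega (S n) <= K * omega n.
Proof.
  intros Hom Hlim.
  apply is_lim_seq_inv in Hlim; [|intros H; injection H; lra].
  destruct (maj_by_pos (fun n => / (omega n / omega (S n)))) as (K & HK0 & HK).
  { exists (/ 1); apply is_lim_seq_Reals, Hlim. }
  exists K; split; [exact HK0|]; intros n.
  specialize (HK n); apply Rle_trans with (1 := Rle_abs _) in HK.
  assert (H0 := Hom n); assert (H1 := Hom (S n)).
  apply (Rmult_le_compat_r (omega n)) in HK; [|lra].
  replace (/ (omega n / omega (S n)) * omega n) with (omega (S n)) in HK by (field; lra).
  exact HK.
Qed.

Lemma rayleigh_le_of_l2_bound (omega : nat -> R) (M : R) :
  (forall n, 0 < omega n) ->
  is_lim_seq (fun n => omega n / omega (S n)) 1 ->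
  l2_bound (jacobi omega) M ->
  forall r, rayleigh_set omega r -> r <= M / 2.
Proof.
  intros Hom Hlim HM r (f & (a & Ha & Hnorm) & Hf & ->).
  destruct (weight_ratio_bounded omega Hom Hlim) as (K & HK0 & HK).
  assert (Hpos : forall k, 0 <= Cmod (a k) ^ 2 * omega (S k)).
  { intros k; apply Rmult_le_pos; [apply pow2_ge_0 | apply Rlt_le, Hom]. }
  assert (Hex : ex_series (fun k => Cmod (a k) ^ 2 * omega (S k))).
  { apply (ex_series_le (V := R_CompleteNormedModule) _
      (fun k => K * (Cmod (a k) ^ 2 * omega k))).
    - intros k; change (Rabs (Cmod (a k) ^ 2 * omega (S k)) <= K * (Cmod (a k) ^ 2 * omega k)).
      rewrite Rabs_pos_eq by apply Hpos.
      assert (H := Rmult_le_compat_l _ _ _ (pow2_ge_0 (Cmod (a k))) (HK k)); lra.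
    - apply (ex_series_scal K (fun k => Cmod (a k) ^ 2 * omega k)), Hnorm. }
  assert (Hinner : Cmod (inner_H2 omega f (shift f))
    <= M / 2 * norm_H2 omega (shift f) ^ 2).
  { rewrite (inner_shift _ _ _ Ha), (norm_shift_sqr _ _ _ Hom Ha Hex).
    apply Cmod_CSeries_le; intros n.
    (* The moduli of the terms of [<f,zf>] are exactly the terms of the form at the nonnegative
       sequence [normalized omega a]. *)
    apply Rle_trans with (jacobi_form (jacobi_weight omega) (normalized omega a) n).
    - right; apply sum_eq; intros k _; unfold normalized.
      rewrite jacobi_weight_mult by exact Hom.
      rewrite !Cmod_mult, Cmod_conj, Cmod_R, Rabs_pos_eq by apply Rlt_le, Hom.
      reflexivity.
    - destruct HM as [HM0 HM].
      eapply Rle_trans.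
      + apply jacobi_form_le_of_action_le; [exact HM0|].
        apply action_le_of_l2_bound; split; assumption.
      + apply Rmult_le_compat_l; [lra|].
        rewrite (sum_eq _ (fun k => Cmod (a k) ^ 2 * omega (S k)))
          by (intros; apply normalized_sqr, Hom).
        apply sum_f_R0_le_Series; assumption. }
  (* The quotient must have a nonzero denominator: if [zf] had norm zero, all coefficients and hence
     [f] would vanish. *)
  assert (Hne : 0 < norm_H2 omega (shift f) ^ 2).
  { rewrite (norm_shift_sqr _ _ _ Hom Ha Hex).
    apply Rnot_le_lt; intros Hle; apply Hf.
    assert (Hzero : forall n, a n = RtoC 0).
    { intros n.
      assert (Hsum := sum_f_R0_le_Series _ n Hpos Hex).
      assert (Hn : Cmod (a n) ^ 2 * omega (S n) <= 0).
      { assert (H := sum_f_R0_term_le _ n n Hpos (le_n n)); simpl in *; lra. }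
      apply Cmod_eq_0.
      assert (H0 := Cmod_ge_0 (a n)); assert (H1 := Hom (S n)).
      apply Rle_antisym; [|exact H0].
      apply Rnot_lt_le; intros Hlt.
      assert (H2 := Rmult_lt_0_compat _ _ (pow_lt _ 2 Hlt) H1); lra. }
    apply functional_extensionality; intros z.
    assert (Hz := Ha z).
    apply (filterlim_locally_unique (F := eventually)
      (sum_n (G := C_NormedModule) (fun k => scal (pow_n (K := C_AbsRing) (proj1_sig z) k) (a k)))).
    - exact Hz.
    - apply filterlim_ext with (fun _ => RtoC 0); [|apply filterlim_const].
      intros n; induction n as [|n IH].
      + rewrite sum_O, Hzero; symmetry; apply (scal_zero_r (V := C_NormedModule)).
      + rewrite sum_Sn, <- IH, Hzero.
        rewrite (scal_zero_r (V := C_NormedModule)); symmetry; apply plus_zero_r. }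
  apply (Rmult_le_reg_r _ _ _ Hne); unfold Rdiv at 1.
  rewrite Rmult_assoc, Rinv_l, Rmult_1_r by lra; exact Hinner.
Qed.

(** The witness is the polynomial with coefficients [u k / sqrt (omega (S k))]: the normalisation is
    undone while the signs of [u] are kept. *)
Lemma rayleigh_set_form (omega u : nat -> R) (n : nat) :
  (forall n, 0 < omega n) ->
  (forall k, (n < k)%nat -> u k = 0) ->
  0 < sum_f_R0 (fun k => u k ^ 2) n ->
  rayleigh_set omega
    (Rabs (jacobi_form (jacobi_weight omega) u n) / sum_f_R0 (fun k => u k ^ 2) n).
Proof.
  intros Hom Hu Hpos.
  set (a := fun k => RtoC (u k / sqrt (omega (S k)))).
  set (term := fun (z : disk) k => scal (V := C_NormedModule) (pow_n (K := C_AbsRing) (proj1_sig z) k) (a k)).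
  set (f := fun z : disk => sum_n (term z) n : C).
  assert (Ha0 : forall k, (n < k)%nat -> a k = RtoC 0).
  { intros k Hk; unfold a; rewrite Hu by exact Hk; f_equal; unfold Rdiv; ring. }
  assert (Ha : power_expansion f a).
  { intros z; apply (is_series_finite (V := C_NormedModule)).
    intros k Hk; rewrite Ha0 by exact Hk; apply (scal_zero_r (V := C_NormedModule)). }
  assert (Hsqrt : forall k, 0 < sqrt (omega (S k))) by (intros; apply sqrt_lt_R0, Hom).
  assert (Hsqr : forall k, Cmod (a k) ^ 2 * omega (S k) = u k ^ 2).
  { intros k; rewrite Cmod_sqr; simpl fst; simpl snd.
    rewrite <- (sqrt_sqrt (omega (S k))) at 2 by apply Rlt_le, Hom.
    specialize (Hsqrt k); field; lra. }
  assert (Hfin : forall w, ex_series (fun k => Cmod (a k) ^ 2 * w k)).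
  { intros w; eexists; apply (is_series_finite (V := R_NormedModule) _ n).
    intros k Hk; rewrite Ha0, Cmod_0 by exact Hk; unfold zero; simpl; ring. }
  exists f; split; [|split].
  - exists a; split; [exact Ha | apply Hfin].
  - intros Hf0.
    assert (Ha' : a = fun _ => RtoC 0).
    { apply power_expansion_unique with f; [exact Ha|].
      rewrite Hf0; intros z.
      assert (H := is_series_finite (V := C_NormedModule)
        (fun k => scal (pow_n (K := C_AbsRing) (proj1_sig z) k) (RtoC 0 : C_NormedModule)) 0%nat
        (fun k _ => scal_zero_r _)).
      rewrite sum_O, (scal_zero_r (V := C_NormedModule)) in H; exact H. }
    rewrite (sum_eq _ (fun _ => 0)), sum_cte in Hpos; [lra|].
    intros k _; rewrite <- Hsqr, Ha', Cmod_0; ring.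
  - rewrite (norm_shift_sqr _ _ _ Hom Ha) by apply Hfin.
    f_equal.
    (* The coefficients are real, so [<f,zf>] is the real number [jacobi_form], with zero imaginary
       part. *)
    + rewrite (inner_shift _ _ _ Ha), <- Cmod_R; f_equal.
      unfold CSeries, jacobi_form.
      rewrite <- (Series_finite (fun k => jacobi_weight omega (S k) * u (S k) * u k)).
      2: { intros k Hk; rewrite (Hu k Hk); ring. }
      unfold RtoC at 1; f_equal.
      * apply Series_ext; intros k.
        set (p := u (S k) / sqrt (omega (S (S k)))).
        set (q := u k / sqrt (omega (S k))).
        symmetry; transitivity (p * q * omega (S k)); [unfold a; simpl; fold p q; ring|].
        rewrite <- jacobi_weight_mult by exact Hom; unfold p, q.
        assert (H0 := Hsqrt k); assert (H1 := Hsqrt (S k)); field; lra.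
      * rewrite (Series_ext _ (fun _ => 0)).
        -- rewrite (Series_finite _ 0%nat) by reflexivity; reflexivity.
        -- intros k; simpl; ring.
    + f_equal; symmetry; rewrite (Series_finite _ n).
      * apply sum_eq; intros; apply Hsqr.
      * intros k Hk; rewrite Hsqr, Hu by exact Hk; ring.
Qed.

(** A constant function is the witness. A nonnegative quotient forces every upper bound to be
    nonnegative. *)
Lemma rayleigh_set_inhabited (omega : nat -> R) :
  (forall n, 0 < omega n) -> exists r, 0 <= r /\ rayleigh_set omega r.
Proof.
  intros Hom.
  eexists; split; [|apply (rayleigh_set_form omega (fun k => match k with O => 1 | _ => 0 end) 0 Hom)].
  - apply Rdiv_le_0_compat; [apply Rabs_pos | simpl; lra].
  - intros [|k] Hk; [lia | reflexivity].
  - simpl; lra.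
Qed.

Lemma l2_bound_of_rayleigh_le (omega : nat -> R) (r : R) :
  (forall n, 0 < omega n) ->
  (forall s, rayleigh_set omega s -> s <= r) ->
  l2_bound (jacobi omega) (2 * r).
Proof.
  intros Hom Hr.
  assert (Hr0 : 0 <= r).
  { destruct (rayleigh_set_inhabited omega Hom) as (s & Hs0 & Hs).
    specialize (Hr s Hs); lra. }
  apply l2_bound_of_action_le; [lra|].
  apply jacobi_action_le_of_form_le; [exact Hr0|].
  intros n u Hu.
  destruct (Rle_lt_or_eq_dec _ _ (sum_sqr_nonneg u n)) as [Hpos|Heq].
  - assert (H := Hr _ (rayleigh_set_form omega u n Hom Hu Hpos)).
    apply (Rmult_le_compat_r _ _ _ (Rlt_le _ _ Hpos)) in H.
    unfold Rdiv in H; rewrite Rmult_assoc, Rinv_l, Rmult_1_r in H by lra; exact H.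
  (* With a zero sum of squares there is no quotient to use, but then [u = 0] and both sides
     vanish. *)
  - rewrite <- Heq.
    assert (Hu0 : forall k, u k = 0).
    { intros k; destruct (Nat.le_gt_cases k n) as [Hk|Hk]; [|apply Hu, Hk].
      assert (Hk0 := sum_f_R0_term_le (fun k => u k ^ 2) k n (fun k => pow2_ge_0 (u k)) Hk).
      assert (H := pow2_ge_0 (u k)).
      apply Rsqr_0_uniq; rewrite Rsqr_pow2; simpl in Hk0, H, Heq |- *; lra. }
    unfold jacobi_form; rewrite (sum_eq _ (fun _ => 0)), sum_cte, Rmult_0_l, Rabs_R0; [lra|].
    intros k _; rewrite !Hu0; ring.
Qed.

(** * Supremum and infimum in the extended reals *)

(** The two implications say that [D] consists of the doubles of the real upper bounds of [E], and
    the supremum of [E] is the least of these bounds. The element of [E] rules out [m_infty]. *)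
Lemma Lub_Rbar_half_Glb_Rbar (E D : R -> Prop) :
  (exists e, E e) ->
  (forall M, D M -> forall e, E e -> e <= M / 2) ->
  (forall b, (forall e, E e -> e <= b) -> D (2 * b)) ->
  Lub_Rbar E = Rbar_div (Glb_Rbar D) 2.
Proof.
  intros [e0 He0] HDE HED; apply is_lub_Rbar_unique.
  destruct (Glb_Rbar_correct D) as [Hlb Hgreatest].
  assert (Hub : forall e, E e -> Rbar_le (2 * e) (Glb_Rbar D)).
  { intros e He; apply Hgreatest; intros M HM.
    specialize (HDE M HM e He); simpl; lra. }
  assert (Hleast : forall b, (forall e, E e -> e <= b) -> Rbar_le (Glb_Rbar D) (2 * b))
    by (intros b Hb; apply Hlb, HED, Hb).
  unfold Rbar_div; destruct (Glb_Rbar D) as [g| |]; simpl Rbar_inv.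
  - split.
    + intros e He; specialize (Hub e He); simpl in *; lra.
    + intros [b| |] Hb; [|exact I|exact (Hb e0 He0)].
      specialize (Hleast b Hb); simpl in *; lra.
  (* A real upper bound [b] of [E] would put [2 * b] above the infimum of [D], so an infinite
     infimum leaves [E] unbounded. *)
  - replace (Rbar_mult p_infty (/ 2)) with p_infty.
    2: { symmetry; apply is_Rbar_mult_unique, is_Rbar_mult_p_infty_pos; simpl; lra. }
    split.
    + intros e _; exact I.
    + intros [b| |] Hb; [destruct (Hleast b Hb)|exact I|exact (Hb e0 He0)].
  - destruct (Hub e0 He0).
Qed.

Theorem theorem4p2 (omega : nat -> R)
  (omega_pos : forall n : nat, 0 < omega n)
  (omega_0 : omega 0%nat = 1)
  (omega_lim : is_lim_seq (fun n => omega n / omega (S n)) 1) :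
  U_const omega = Rbar_div (op_norm (jacobi omega)) 2.
Proof.
  apply (Lub_Rbar_half_Glb_Rbar (rayleigh_set omega) (l2_bound (jacobi omega))).
  - destruct (rayleigh_set_inhabited omega omega_pos) as (r & _ & Hr); exists r; exact Hr.
  - intros M HM; exact (rayleigh_le_of_l2_bound omega M omega_pos omega_lim HM).
  - intros r Hr; exact (l2_bound_of_rayleigh_le omega r omega_pos Hr).
Qed.
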